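(* Let $\mathcal{H}=L^2(\mathbb{R}^\times,dt/|t|)$ and $G=\mathbb{R}\rtimes\mathbb{R}^\times$. Then $\Psi P_{\rm diag}=P_e\Psi$ as maps $\mathcal{H}\widehat{\otimes}\overline{\mathcal{H}}\to\mathrm{A}(G)$.
   Context: $\mathbb{R}^\times$ is the multiplicative group of non-zero reals with Haar measure $dt/|t|$; $\mathcal{H}=L^2(\mathbb{R}^\times,dt/|t|)$, with inner product linear in the first variable; $\overline{\mathcal{H}}$ is the conjugate Hilbert space and $\widehat{\otimes}$ is the projective tensor product. $G=\mathbb{R}\rtimes\mathbb{R}^\times=\{(b,a):b\in\mathbb{R},a\in\mathbb{R}^\times\}$ with multiplication $(b,a)(b',a')=(ab'+b,aa')$. The unitary representation $\pi$ of $G$ on $\mathcal{H}$ is $(\pi(b,a)\xi)(t)=e^{2\pi i bt}\xi(ta)$. $\mathrm{A}(G)$ is the Fourier algebra of $G$ (the coefficient space of the left regular representation of $G$ on $L^2(G)$); it coincides with the coefficient space $\mathrm{A}_\pi(G)$ of $\pi$, and $\Psi:\mathcal{H}\widehat{\otimes}\overline{\mathcal{H}}\to\mathrm{A}_\pi(G)=\mathrm{A}(G)$ is the isometric linear isomorphism determined by $\Psi(\xi\otimes\eta)(b,a)=\langle\pi(b,a)\xi,\eta\rangle$. $P_e:\mathrm{A}(G)\to\mathrm{A}(G)$ is the contractive projection given by $P_e(f)(b,a)=f(b,a)$ if $a>0$ and $P_e(f)(b,a)=0$ if $a<0$ (restriction to the open subgroup $\{(b,a):a>0\}$ followed by extension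 by zero). $\mathcal{H}^+=\{\xi\in\mathcal{H}:\xi(t)=0\text{ for a.e. }t<0\}$, $\mathcal{H}^-=\{\xi\in\mathcal{H}:\xi(t)=0\text{ for a.e. }t>0\}$, $P^\pm$ is the orthogonal projection of $\mathcal{H}$ onto $\mathcal{H}^\pm$, and $P_{\rm diag}$ is the bounded linear map on $\mathcal{H}\widehat{\otimes}\overline{\mathcal{H}}$ determined by $P_{\rm diag}(\xi\otimes\eta)=P^+\xi\otimes P^+\eta+P^-\xi\otimes P^-\eta$. *)

(* Defs.v *)
From HB Require Import structures.
From mathcomp Require Import all_boot all_order all_algebra.
From mathcomp Require Import complex.
From mathcomp Require Import all_classical all_reals all_analysis.
From mathcomp Require Import measurable_realfun.

Set Implicit Arguments.
Unset Strict Implicit.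
Unset Printing Implicit Defensive.

Import Order.TTheory GRing.Theory Num.Theory.
Import numFieldNormedType.Exports.

Local Open Scope classical_set_scope.
Local Open Scope ring_scope.
Local Open Scope complex_scope.
Local Open Scope quotient_scope.

Section L2_functions.
Context {d} {T : measurableType d} {R : realType}.
Variable mu : {measure set T -> \bar R}.
Implicit Types f g : T -> R[i]^o.

Definition cmeasurable f :=
  measurable_fun setT (fun t => complex.Re (f t)) /\
  measurable_fun setT (fun t => complex.Im (f t)).

Definition cLnorm2 f : \bar R := ('N[mu]_2%:E[EFin \o (fun t => Normc.normc (f t))])%E.

Definition sqint : {pred T -> R[i]^o} :=
  [pred f | `[< cmeasurable f /\ (cLnorm2 f < +oo)%E >]].

Lemma sqintP f : reflect (cmeasurable f /\ (cLnorm2 f < +oo)%E) (f \in sqint).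
Proof. exact: asboolP. Qed.

Lemma cmeasurableD f g : cmeasurable f -> cmeasurable g -> cmeasurable (f + g).
Proof.
move=> [f1 f2] [g1 g2]; split.
- rewrite (_ : (fun t => _) = (fun t => complex.Re (f t)) \+
    (fun t => complex.Re (g t))); first exact: measurable_funD.
  by apply/funext => t; rewrite fctE/=; case: (f t); case: (g t).
- rewrite (_ : (fun t => _) = (fun t => complex.Im (f t)) \+
    (fun t => complex.Im (g t))); first exact: measurable_funD.
  by apply/funext => t; rewrite fctE/=; case: (f t); case: (g t).
Qed.

Lemma cmeasurableZ (a : R[i]) f : cmeasurable f -> cmeasurable (a *: f).
Proof.
move=> [f1 f2]; split.
- rewrite (_ : (fun t => _) = (fun t => complex.Re a * complex.Re (f t)) \-
    (fun t => complex.Im a * complex.Im (f t))).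
    by apply: measurable_funB; apply: measurable_funM.
  by apply/funext => t; rewrite fctE/=; case: a; case: (f t).
- rewrite (_ : (fun t => _) = (fun t => complex.Re a * complex.Im (f t)) \+
    (fun t => complex.Im a * complex.Re (f t))).
    by apply: measurable_funD; apply: measurable_funM.
  by apply/funext => t; rewrite fctE/=; case: a; case: (f t).
Qed.

Lemma normc_measurable f : cmeasurable f ->
  measurable_fun setT (fun t => Normc.normc (f t)).
Proof.
move=> [f1 f2]; rewrite (_ : (fun t => _) = (fun t =>
  Num.sqrt (complex.Re (f t) ^+ 2 + complex.Im (f t) ^+ 2))).
  apply: (@measurableT_comp _ _ _ _ _ _ (@Num.sqrt R)).
    by apply: continuous_measurable_fun; exact: sqrt_continuous.
  by apply: measurable_funD; apply: measurable_funX.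
by apply/funext => t; case: (f t).
Qed.

Lemma le_Lnorm2 (f g : T -> R) : measurable_fun setT f -> measurable_fun setT g ->
  (forall t, 0 <= f t <= g t) ->
  ('N[mu]_2%:E[EFin \o f] <= 'N[mu]_2%:E[EFin \o g])%E.
Proof.
move=> mf mg fg; rewrite unlock /Lnorm.
have mX (h : T -> R) : measurable_fun setT h ->
    measurable_fun setT (fun x => `|(EFin \o h) x| `^ 2)%E.
  move=> mh; apply: (@measurableT_comp _ _ _ _ _ _ (@poweR R ^~ 2)) => //.
    exact: measurable_poweR.
  by apply: measurableT_comp => //; exact/measurable_EFinP.
apply: gt0_ler_poweR => //.
- by rewrite in_itv/= leey integral_ge0// => x _; rewrite poweR_ge0.
- by rewrite in_itv/= leey integral_ge0// => x _; rewrite poweR_ge0.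
- apply: ge0_le_integral => //.
  + by move=> x _; rewrite poweR_ge0.
  + exact: mX.
  + exact: mX.
  + move=> x _; have /andP[f0 fgx] := fg x.
    apply: gt0_ler_poweR; rewrite ?in_itv/= ?leey ?andbT ?lee_fin//.
    by rewrite !ger0_norm// (le_trans f0).
Qed.

Lemma cLnorm2D f g : cmeasurable f -> cmeasurable g ->
  (cLnorm2 (f + g)%R <= cLnorm2 f + cLnorm2 g)%E.
Proof.
move=> mf mg; have nf := normc_measurable mf; have ng := normc_measurable mg.
apply: le_trans (eminkowski _ nf ng _); last by rewrite lee_fin ler1n.
apply: le_Lnorm2; [exact/normc_measurable/cmeasurableD|exact: measurable_funD|].
move=> t; rewrite le_normcD andbT.
by case: ((f + g) t) => a b /=; rewrite sqrtr_ge0.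
Qed.

Lemma cLnorm2_ge0 f : (0 <= cLnorm2 f)%E.
Proof. exact: Lnorm_ge0. Qed.

Lemma cLnorm2Z (a : R[i]) f : f \in sqint ->
  cLnorm2 (a *: f) = ((Normc.normc a)%:E * cLnorm2 f)%E.
Proof.
move=> /sqintP[mf nf].
have fL : (fun t => Normc.normc (f t)) \in Lfun mu 2%:E.
  by rewrite inE; apply/andP; split; rewrite inE//; exact: normc_measurable.
have := LnormZ (Lfun_Sub (lee1n 2) fL) (Normc.normc a).
rewrite ger0_norm; last by case: (a) => ? ? /=; rewrite sqrtr_ge0.
move=> <-; rewrite /cLnorm2; congr (Lnorm _ _ _).
by apply/funext => t; rewrite /comp; congr EFin; exact: Normc.normcM.
Qed.

Lemma sqint_submod_closed : submod_closed sqint.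
Proof.
have sq0 : (0 : T -> R[i]^o) \in sqint.
  apply/sqintP; split; first by split; exact: measurable_cst.
  rewrite /cLnorm2 (_ : _ \o _ = cst 0%E) ?Lnorm0 ?ltry//.
  by apply/funext => t; rewrite /comp; congr EFin; exact: Normc.normc0.
split => // a f g fP gP.
have [mf nf] := sqintP _ fP; have [mg ng] := sqintP _ gP.
have maf := cmeasurableZ a mf.
apply/sqintP; split; first exact: cmeasurableD.
apply: le_lt_trans (cLnorm2D maf mg) _; rewrite lte_add_pinfty// cLnorm2Z//.
by rewrite lte_mul_pinfty// lee_fin; case: (a) => ? ? /=; rewrite sqrtr_ge0.
Qed.

HB.instance Definition _ :=
  GRing.isSubmodClosed.Build _ _ sqint sqint_submod_closed.

Definition L2fun := {f : T -> R[i]^o | f \in sqint}.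
HB.instance Definition _ := SubChoice.on L2fun.
HB.instance Definition _ := [SubChoice_isSubLmodule of L2fun by <:].

Definition L2null : {pred L2fun} :=
  [pred f : L2fun | `[< {ae mu, forall t, \val f t = 0} >]].

Lemma L2null_zmod_closed : zmod_closed L2null.
Proof.
split; first by apply/asboolP; exact: aeW.
move=> f g /asboolP f0 /asboolP g0; apply/asboolP.
by apply: filterS2 f0 g0 => t f0 g0; rewrite -[LHS]/(\val f t - \val g t) f0 g0 subrr.
Qed.

HB.instance Definition _ :=
  GRing.isZmodClosed.Build _ L2null L2null_zmod_closed.

Definition L2 := Quotient.quot L2null.
HB.instance Definition _ := GRing.Zmodule.on L2.
HB.instance Definition _ := EqQuotient.on L2.

Definition L2_fun (x : L2) : T -> R[i]^o := \val (repr x).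

Lemma L2_piP (f g : L2fun) :
  \pi_L2 f = \pi_L2 g <-> {ae mu, forall t, \val f t = \val g t}.
Proof.
have -> : (\pi_L2 f = \pi_L2 g) = (f - g \in L2null).
  by apply/propext; rewrite Quotient.idealrBE; split => [->|/eqP].
split => [/asboolP|] fg; last apply/asboolP; apply: filterS fg => t.
  by rewrite -[LHS]/(\val f t - \val g t) => /subr0_eq.
by move=> fg; rewrite -[LHS]/(\val f t - \val g t) fg subrr.
Qed.

Lemma L2_pi_fun (f : L2fun) : {ae mu, forall t, L2_fun (\pi_L2 f) t = \val f t}.
Proof. by apply/L2_piP; rewrite reprK. Qed.

Lemma L2_eqP (x y : L2) : x = y <-> {ae mu, forall t, L2_fun x t = L2_fun y t}.
Proof. by rewrite -L2_piP !reprK. Qed.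

Definition L2_scale (a : R[i]) (x : L2) : L2 := \pi_L2 (a *: repr x).

Lemma L2_scale_pi a (f : L2fun) : L2_scale a (\pi_L2 f) = \pi_L2 (a *: f).
Proof.
apply/L2_piP; apply: filterS (L2_pi_fun f) => t ft.
by rewrite -[LHS]/(a *: L2_fun (\pi_L2 f) t) ft.
Qed.

Lemma L2_scaleA a b x : L2_scale a (L2_scale b x) = L2_scale (a * b) x.
Proof.
by elim/quotW: x => f; rewrite (L2_scale_pi b) (L2_scale_pi a) L2_scale_pi scalerA.
Qed.

Lemma L2_scale1 : left_id 1 L2_scale.
Proof. by elim/quotW => f; rewrite L2_scale_pi scale1r. Qed.

Lemma L2_scaleDr : right_distributive L2_scale +%R.
Proof.
move=> a; elim/quotW => f; elim/quotW => g.
by rewrite -raddfD (L2_scale_pi a (f + g)) !L2_scale_pi -raddfD scalerDr.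
Qed.

Lemma L2_scaleDl x : {morph L2_scale^~ x : a b / a + b}.
Proof.
by move=> a b; elim/quotW: x => f; rewrite !L2_scale_pi -raddfD scalerDl.
Qed.

HB.instance Definition _ := GRing.Zmodule_isLmodule.Build R[i] L2
  L2_scaleA L2_scale1 L2_scaleDr L2_scaleDl.

Definition L2_norm (x : L2) : R[i] := (fine (cLnorm2 (L2_fun x)))%:C.

Lemma sqint_val (f : L2fun) : \val f \in sqint. Proof. exact: valP. Qed.

Lemma ae_eq_cLnorm2 (f g : L2fun) : {ae mu, forall t, \val f t = \val g t} ->
  cLnorm2 (\val f) = cLnorm2 (\val g).
Proof.
move=> fg; rewrite /cLnorm2 unlock /Lnorm; congr (_ `^ _)%E.
have /sqintP[mf _] := sqint_val f; have /sqintP[mg _] := sqint_val g.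
have mX (h : T -> R) : measurable_fun setT h ->
    measurable_fun setT (fun x => `|(EFin \o h) x| `^ 2)%E.
  move=> mh; apply: (@measurableT_comp _ _ _ _ _ _ (@poweR R ^~ 2)) => //.
    exact: measurable_poweR.
  by apply: measurableT_comp => //; exact/measurable_EFinP.
apply: ae_eq_integral => //; [exact/mX/normc_measurable|exact/mX/normc_measurable|].
by apply: filterS fg => t fgt _; rewrite /comp fgt.
Qed.

Lemma L2_normD x y : L2_norm (x + y) <= L2_norm x + L2_norm y.
Proof.
have fin (f : L2fun) : cLnorm2 (\val f) \is a fin_num.
  by have /sqintP[_ ?] := sqint_val f; rewrite ge0_fin_numE// cLnorm2_ge0.
have /sqintP[mx _] := sqint_val (repr x); have /sqintP[my _] := sqint_val (repr y).
rewrite /L2_norm -raddfD lecR -fineD ?fin//.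
apply: fine_le; rewrite ?fin ?fin_numD ?fin//.
have -> : cLnorm2 (L2_fun (x + y)) = cLnorm2 (\val (repr x + repr y)).
  by apply: ae_eq_cLnorm2; apply/L2_piP; rewrite reprK -{1}[x]reprK -{1}[y]reprK -raddfD.
exact: cLnorm2D.
Qed.

Lemma L2_normZ (a : R[i]) x : L2_norm (a *: x) = `|a| * L2_norm x.
Proof.
have -> : L2_norm (a *: x) = (fine (cLnorm2 (\val (a *: repr x))))%:C.
  by congr (fine _)%:C; apply: ae_eq_cLnorm2; exact: L2_pi_fun.
have fx : cLnorm2 (L2_fun x) \is a fin_num.
  by have /sqintP[_ ?] := sqint_val (repr x); rewrite ge0_fin_numE// cLnorm2_ge0.
rewrite (cLnorm2Z a (sqint_val (repr x))) fineM//= rmorphM/=.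
by congr (_ * _); rewrite normc_def; case: (a).
Qed.

Lemma L2_norm0_eq0 x : L2_norm x = 0 -> x = 0.
Proof.
have /sqintP[mx nx] := sqint_val (repr x).
move=> /(congr1 (@complex.Re R))/= /eqP; rewrite fine_eq0; last first.
  by rewrite ge0_fin_numE// cLnorm2_ge0.
move=> /eqP /Lnorm_eq0_eq0 x0.
rewrite -[x]reprK -[0]reprK; apply/L2_piP.
have x0' : {ae mu, forall t, L2_fun x t = 0}.
  apply: filterS (x0 _ _) => //; last exact/measurable_EFinP/normc_measurable.
  by move=> t /(_ I)[/Normc.eq0_normc].
have z0 : {ae mu, forall t, \val (repr (0 : L2)) t = 0}.
  have -> : (0 : L2) = \pi_L2 0 by rewrite raddf0.
  exact: L2_pi_fun.
by apply: filterS2 x0' z0 => t; rewrite /L2_fun => -> ->.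
Qed.

HB.instance Definition _ :=
  Lmodule_isNormed.Build R[i] L2 L2_normD L2_normZ L2_norm0_eq0.

Definition L2_inner (x y : L2) : R[i] :=
  let h t := L2_fun x t * (L2_fun y t)^* in
  (\int[mu]_t complex.Re (h t)) +i* (\int[mu]_t complex.Im (h t)).

(* The class of f; it is 0 when f is not almost everywhere equal to a
   square-integrable function. *)
Definition L2_class (f : T -> R[i]) : L2 :=
  xget 0 [set x | {ae mu, forall t, L2_fun x t = f t}].

Lemma L2_classE f : f \in sqint -> {ae mu, forall t, L2_fun (L2_class f) t = f t}.
Proof.
move=> fP; apply: (@xgetPex _ 0 [set x | {ae mu, forall t, L2_fun x t = f t}]).
exists (\pi_L2 (Sub f fP)); exact: (L2_pi_fun (Sub f fP)).
Qed.

Definition orth_proj (S : set L2) (x : L2) : L2 :=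
  xget 0 [set y | S y /\ forall z, S z -> L2_inner (x - y) z = 0].

End L2_functions.

Arguments L2_fun {d T R mu} x t.
Arguments L2_inner {d T R mu} x y.
Arguments orth_proj {d T R mu} S x.

(* The space of coefficients of rho, i.e. of the functions
   g |-> \sum_n <rho g xi_n, eta_n> with \sum_n |xi_n| |eta_n| < +oo, is the set
   where this norm is finite. *)
Section coefficient_space.
Context {d} {T : measurableType d} {R : realType}.
Context {mu : {measure set T -> \bar R}} {G : Type}.
Variable rho : G -> L2 mu -> L2 mu.

Definition coef_expansion (f : G -> R[i]) (xi eta : nat -> L2 mu) :=
  forall g, series (fun n => L2_inner (rho g (xi n)) (eta n) : R[i]^o) @ \oo
    --> (f g : R[i]^o).

Definition coef_norm (f : G -> R[i]) : \bar R := ereal_inf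
  [set s | exists xi eta, coef_expansion f xi eta /\
    s = (\sum_(0 <= n <oo) (complex.Re (`|xi n| * `|eta n|))%:E)%E].

Definition coef_space : set (G -> R[i]) := [set f | (coef_norm f < +oo)%E].

End coefficient_space.

Section conjugate_space.
Context {R : realType}.
Variable V : normedModType R[i].

Definition conj_space : Type := V.
HB.instance Definition _ := GRing.Zmodule.on conj_space.

Let conj_scale (a : R[i]) (x : conj_space) : conj_space := a^* *: (x : V).

Let conj_scaleA a b x : conj_scale a (conj_scale b x) = conj_scale (a * b) x.
Proof. by rewrite /conj_scale scalerA rmorphM. Qed.

Let conj_scale1 : left_id 1 conj_scale.
Proof. by move=> x; rewrite /conj_scale rmorph1 scale1r. Qed.

Let conj_scaleDr : right_distributive conj_scale +%R.
Proof. by move=> a x y; rewrite /conj_scale scalerDr. Qed.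

Let conj_scaleDl x : {morph conj_scale^~ x : a b / a + b}.
Proof. by move=> a b; rewrite /conj_scale rmorphD scalerDl. Qed.

HB.instance Definition _ := GRing.Zmodule_isLmodule.Build R[i] conj_space
  conj_scaleA conj_scale1 conj_scaleDr conj_scaleDl.

Let conj_norm (x : conj_space) : R[i] := `|x : V|.

Let conj_normD x y : conj_norm (x + y) <= conj_norm x + conj_norm y.
Proof. exact: ler_normD. Qed.

Let conj_normZ a x : conj_norm (a *: x) = `|a| * conj_norm x.
Proof. by rewrite [LHS]normrZ normcJ. Qed.

Let conj_norm0 x : conj_norm x = 0 -> x = 0.
Proof. exact: normr0_eq0. Qed.

HB.instance Definition _ :=
  Lmodule_isNormed.Build R[i] conj_space conj_normD conj_normZ conj_norm0.

End conjugate_space.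

Section projective_tensor_product.
Context {K : numFieldType} {V W : normedModType K}.

Definition tensor_sum {Z : lmodType K} (b : V -> W -> Z) (s : seq (V * W)) : Z :=
  \sum_(p <- s) b p.1 p.2.

Definition tensor_cost (s : seq (V * W)) : K := \sum_(p <- s) `|p.1| * `|p.2|.

(* X, with tau v w in the role of v (x) w, is the completion of the algebraic
   tensor product of V and W (the span of tau, by tensor_free) for the norm
   u |-> inf {\sum_i |v_i| |w_i| : u = \sum_i v_i (x) w_i}. *)
Record is_projective_tensor (X : completeNormedModType K)
    (tau : {bilinear V -> W -> X}) : Prop := {
  tensor_free : forall s, tensor_sum tau s = 0 ->
    forall (Z : lmodType K) (b : {bilinear V -> W -> Z}), tensor_sum b s = 0 ;
  tensor_norm_le : forall s, `|tensor_sum tau s| <= tensor_cost s ;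
  tensor_norm_inf : forall s e, 0 < e -> exists2 s',
    tensor_sum tau s' = tensor_sum tau s &
    tensor_cost s' < `|tensor_sum tau s| + e ;
  tensor_dense : dense (range (tensor_sum tau)) }.

End projective_tensor_product.

Section affine_group.
Context {R : realType}.

Definition aff_mul (x y : R * R) : R * R := (x.2 * y.1 + x.1, x.2 * y.2).

Definition affG := {x : R * R | x.2 != 0}.
HB.instance Definition _ := SubChoice.on affG.

Let mul_subproof (g h : affG) : (aff_mul (\val g) (\val h)).2 != 0.
Proof. by rewrite mulf_neq0 ?(svalP g) ?(svalP h). Qed.

Let inv_subproof (g : affG) : (- (\val g).1 / (\val g).2, (\val g).2^-1).2 != 0.
Proof. by rewrite invr_eq0 (svalP g). Qed.

Let one_subproof : ((0, 1) : R * R).2 != 0. Proof. exact: oner_neq0. Qed.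

Let P (x : R * R) : bool := x.2 != 0.
Let mul (g h : affG) : affG := exist P _ (mul_subproof g h).
Let inv (g : affG) : affG := exist P _ (inv_subproof g).
Let one : affG := exist P _ one_subproof.

Let mulA : associative mul.
Proof.
move=> g h k; apply: val_inj; rewrite /= /aff_mul/= mulrA; congr (_, _).
by rewrite mulrDr mulrA addrA.
Qed.

Let mul1 : left_id one mul.
Proof.
move=> g; apply: val_inj.
by rewrite /= /aff_mul/= !mul1r addr0 -surjective_pairing.
Qed.

Let mulr1' : right_id one mul.
Proof.
move=> g; apply: val_inj.
by rewrite /= /aff_mul/= mulr0 add0r mulr1 -surjective_pairing.
Qed.

Let mulV : left_inverse one inv mul.
Proof.
move=> g; apply: val_inj; rewrite /= /aff_mul/= mulVf ?(svalP g)//.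
by rewrite [_^-1 * _]mulrC mulNr subrr.
Qed.

Let mulrV' : right_inverse one inv mul.
Proof.
move=> g; apply: val_inj; rewrite /= /aff_mul/= mulfV ?(svalP g)//.
by rewrite mulrC divfK ?(svalP g)// addNr.
Qed.

HB.instance Definition _ := isGroup.Build affG mulA mul1 mulr1' mulV mulrV'.

End affine_group.
Arguments affG : clear implicits.

Lemma density_sigma_additive {d} {T : measurableType d} {R : realType}
    (mu : {measure set T -> \bar R}) (w : T -> R) :
  measurable_fun setT w -> (forall t, 0 <= w t) ->
  semi_sigma_additive (fun A => \int[mu]_(t in A) (w t)%:E)%E.
Proof.
move=> mw w0 A mA tA mUA; rewrite ge0_integral_bigcup//=.
- apply: is_cvg_ereal_nneg_natsum_cond => n _ _.
  by apply: integral_ge0 => t _; rewrite lee_fin.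
- by apply/measurable_EFinP; exact: measurable_funTS.
- by move=> t _; rewrite lee_fin.
Qed.

Section haar.
Context {R : realType}.
Local Notation leb := (@lebesgue_measure R).

Definition mul_haar (A : set (measurableTypeR R)) : \bar R :=
  (\int[leb]_(t in A) (`|t|^-1)%:E)%E.

Let mV : measurable_fun setT (fun t : measurableTypeR R => `|t|^-1).
Proof.
rewrite (_ : (fun t => _) = (fun t : R => `|t| `^ (-1))).
  exact: (@measurableT_comp _ _ _ _ _ _ (@powR R ^~ (-1))).
by apply/funext => t; rewrite powR_inv1.
Qed.

Let mul_haar0 : mul_haar set0 = 0%E. Proof. exact: integral_set0. Qed.
Let mul_haar_ge0 A : (0 <= mul_haar A)%E.
Proof. by apply: integral_ge0 => t _; rewrite lee_fin invr_ge0. Qed.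
Let mul_haar_sigma_additive : semi_sigma_additive mul_haar.
Proof. by apply: density_sigma_additive => // t; rewrite invr_ge0. Qed.

HB.instance Definition _ := isMeasure.Build _ _ _
  mul_haar mul_haar0 mul_haar_ge0 mul_haar_sigma_additive.

(* The left Haar measure db da / a^2. *)
Definition aff_haar (A : set (measurableTypeR R * measurableTypeR R)) : \bar R :=
  (\int[(leb \x leb)%E]_(x in A) (`|x.2| ^- 2)%:E)%E.

Let aff_haar0 : aff_haar set0 = 0%E. Proof. exact: integral_set0. Qed.
Let aff_haar_ge0 A : (0 <= aff_haar A)%E.
Proof. by apply: integral_ge0 => x _; rewrite lee_fin invr_ge0 exprn_ge0. Qed.
Let aff_haar_sigma_additive : semi_sigma_additive aff_haar.
Proof.
apply: density_sigma_additive => [|x]; last by rewrite invr_ge0 exprn_ge0.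
rewrite (_ : (fun x => _) = (fun x : measurableTypeR R * measurableTypeR R =>
    (`|x.2|^-1) ^+ 2)).
  by apply: measurable_funX; exact: (measurableT_comp mV).
by apply/funext => x; rewrite exprVn.
Qed.

HB.instance Definition _ := isMeasure.Build _ _ _
  aff_haar aff_haar0 aff_haar_ge0 aff_haar_sigma_additive.

End haar.

Section main_objects.
Variable R : realType.

(* Functions on the multiplicative group, resp. on the affine group, are extended
   arbitrarily to t = 0, resp. a = 0: these are null sets. Both actions below send
   square-integrable functions to square-integrable functions, so the default value
   of L2_class is not used. *)
Definition L2mul := L2 (@mul_haar R).
Definition L2aff := L2 (@aff_haar R).

Definition left_regular (g : affG R) (xi : L2aff) : L2aff :=
  L2_class aff_haar (fun x => L2_fun xi (aff_mul (\val (g^-1)%g) x)).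

Definition fourier_norm : (affG R -> R[i]) -> \bar R := coef_norm left_regular.
Definition fourier_algebra : set (affG R -> R[i]) := coef_space left_regular.

Definition aff_rep (g : affG R) (xi : L2mul) : L2mul :=
  let: (b, a) := \val g in
  L2_class mul_haar (fun t =>
    (cos (2 * pi * b * t) +i* sin (2 * pi * b * t)) * L2_fun xi (t * a)).

Definition Hplus : set L2mul :=
  [set xi : L2mul | {ae mul_haar, forall t : R, t < 0 -> L2_fun xi t = 0}].
Definition Hminus : set L2mul :=
  [set xi : L2mul | {ae mul_haar, forall t : R, t > 0 -> L2_fun xi t = 0}].

Definition Pe (f : affG R -> R[i]) : affG R -> R[i] :=
  fun g => if 0 < (\val g).2 then f g else 0.

End main_objects.

(* Main.v *)
Require Import Defs.
From mathcomp Require Import all_boot all_order all_algebra.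
From mathcomp Require Import complex.
From mathcomp Require Import all_classical all_reals all_analysis.
From mathcomp Require Import measurable_realfun.
Import Order.TTheory GRing.Theory Num.Theory.
Import numFieldNormedType.Exports.

Local Open Scope classical_set_scope.
Local Open Scope ring_scope.
Local Open Scope complex_scope.

(** Write D+ and D- for the half-lines t >= 0 and t <= 0, so that the projections
    onto [Hplus] and [Hminus] are multiplication by their indicators
    ([orth_proj_indic]). Up to a character, [pi(b, a)] is the dilation
    t |-> ta. On an elementary tensor, the left-hand side is therefore the
    integral over t of
      e(bt) xi(ta) conj(eta(t)) (1_{D+}(ta) 1_{D+}(t) + 1_{D-}(ta) 1_{D-}(t)).
    If a > 0 the dilation preserves each half-line and the bracket is 1 off
    t = 0; if a < 0 it exchanges them and the bracket is 0 off t = 0. As {0} is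
    a null set, this is exactly the effect of [Pe] ([aff_coef_diag]).

    The identity then extends by linearity to the algebraic tensor product, which
    is dense. To pass to the limit, both sides must be continuous in u once the
    point g of the group is fixed. The isometry only controls the norm of the
    Fourier algebra, so what is needed is that evaluation at g is bounded for it:
    a coefficient of a representation by isometries is bounded by its coefficient
    norm up to a constant, by Cauchy-Schwarz ([normc_le_coef_norm]), and the left
    regular representation is isometric because the measure db da / a^2 is left
    invariant ([aff_haar_invariant]). The constant 2 there comes from estimating
    real and imaginary parts separately, and is harmless for continuity. *)

(** * Invariance of the Haar measures *)

Section lebesgue_affine.
Context {R : realType}.
Local Notation leb := (@lebesgue_measure R).

Definition affine_map (a b : R) (t : measurableTypeR R) : measurableTypeR R :=
  a * t + b.

Lemma measurable_affine_map (a b : R) : measurable_fun setT (affine_map a b).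
Proof. by apply: measurable_funD => //; exact: measurable_funM. Qed.

(** Both sides are measures in A, so intervals ]x, y] suffice: the preimage of
    such an interval is again a half-open interval, with its orientation reversed
    when a < 0. *)
Lemma lebesgue_affine_preimage (a b : R) (A : set (measurableTypeR R)) :
  a != 0 -> measurable A -> leb A = (`|a|%:E * leb (affine_map a b @^-1` A))%E.
Proof.
move=> a0 mA; pose phi := affine_map a b.
have mphi : measurable_fun setT phi := measurable_affine_map a b.
apply: (@lebesgue_measure_unique _
  (mscale (NngNum (normr_ge0 a)) (pushforward leb phi))) => //= _ [[x y] _ <-] /=.
rewrite /mscale /= /pushforward /= lebesgue_measure_itv /= lte_fin.
have [aP|aN|aE] := ltgtP 0 a; last by rewrite aE eqxx in a0.
- have -> : phi @^-1` `]x, y] = `](x - b) / a, (y - b) / a]%classic.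
    apply/seteqP; split => t /=; rewrite !in_itv /=;
      by rewrite ltr_pdivrMr// ler_pdivlMr// ltrBlDr lerBrDr [t * a]mulrC.
  rewrite lebesgue_measure_itv /= lte_fin ltr_pM2r ?invr_gt0// ltrBlDr subrK.
  case: ifP => _; last by rewrite mule0.
  rewrite -!EFinB -EFinM gtr0_norm// -mulrBl mulrC mulfVK ?gt_eqF//.
  by congr _%:E; rewrite opprB addrA subrK.
- have -> : phi @^-1` `]x, y] = `[(y - b) / a, (x - b) / a[%classic.
    apply/seteqP; split => t /=; rewrite !in_itv /=;
      by rewrite ler_ndivrMr// ltr_ndivlMr// ltrBlDr lerBrDr [t * a]mulrC andbC.
  rewrite lebesgue_measure_itv /= lte_fin ltr_nM2r ?invr_lt0// ltrBlDr subrK.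
  case: ifP => _; last by rewrite mule0.
  rewrite -!EFinB -EFinM ltr0_norm// -mulrBl mulNr mulrC mulfVK ?lt_eqF//.
  by congr _%:E; rewrite opprD !opprB [RHS]addrC subrKA.
Qed.

Lemma ge0_integral_affine (a b : R) (f : measurableTypeR R -> \bar R) :
  a != 0 -> measurable_fun setT f -> (forall t, (0 <= f t)%E) ->
  (\int[leb]_t f t = `|a|%:E * \int[leb]_t f (affine_map a b t))%E.
Proof.
move=> a0 mf f0; pose phi := affine_map a b.
have mphi : measurable_fun setT phi := measurable_affine_map a b.
rewrite (@eq_measure_integral _ _ _ _
  (mscale (NngNum (normr_ge0 a)) (pushforward leb phi))) => [|A mA _]; last first.
  exact: lebesgue_affine_preimage.
rewrite ge0_integral_mscale//=; congr (_ * _)%E.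
by rewrite ge0_integral_pushforward.
Qed.

End lebesgue_affine.

(** Composition with phi divides integrals by c, and w = c (w o phi): the two
    factors cancel in the measure w mu. Both Haar measures are of this form, with
    w = |t|^-1 and c = |a|, resp. w = |a|^-2 and c the square of a modulus. *)
Lemma density_measure_preserving {d} {T : measurableType d} {R : realType}
    (mu : {measure set T -> \bar R}) (phi : T -> T) (c : R) (w : T -> R) :
    (forall f, measurable_fun setT f -> (forall t, (0 <= f t)%E) ->
      (\int[mu]_t f t = c%:E * \int[mu]_t f (phi t))%E) ->
    measurable_fun setT phi -> 0 <= c ->
    measurable_fun setT w -> (forall t, 0 <= w t) ->
    (forall t, w t = c * w (phi t)) ->
  forall A, measurable A ->
  (\int[mu]_(t in phi @^-1` A) (w t)%:E = \int[mu]_(t in A) (w t)%:E)%E.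
Proof.
move=> phiE mphi c0 mw w0 wphi A mA.
(* The integral over A is that of the function w 1_A over the whole space. *)
have mwA : measurable_fun setT ((EFin \o w) \_ A).
  by apply/(measurable_restrictT _ mA); exact/measurable_EFinP/measurable_funTS.
have wA0 t : (0 <= ((EFin \o w) \_ A) t)%E.
  by rewrite patchE; case: ifP => // _; rewrite lee_fin.
rewrite [RHS]integral_mkcond phiE// integral_mkcond -ge0_integralZl//.
- apply: eq_integral => t _; rewrite !patchE.
  rewrite (_ : (t \in phi @^-1` A) = (phi t \in A)); last first.
    by apply/idP/idP; rewrite !inE.
  by case: ifP => _; rewrite ?mule0//= -EFinM wphi.
- exact: measurableT_comp mwA mphi.
Qed.

Section haar_invariance.
Context {R : realType}.
Local Notation leb := (@lebesgue_measure R).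
Local Notation mul_haar := (@mul_haar R).
Local Notation aff_haar := (@aff_haar R).

Let measurable_normV : measurable_fun setT (fun t : measurableTypeR R => `|t|^-1).
Proof.
rewrite (_ : (fun t => _) = (fun t : R => `|t| `^ (-1))).
  exact: (@measurableT_comp _ _ _ _ _ _ (@powR R ^~ (-1))).
by apply/funext => t; rewrite powR_inv1.
Qed.

Lemma mul_haar_invariant (a : R) (A : set (measurableTypeR R)) :
  a != 0 -> measurable A ->
  mul_haar ((fun t : measurableTypeR R => t * a) @^-1` A) = mul_haar A.
Proof.
move=> a0 mA.
apply: (density_measure_preserving _ _ `|a|) => //.
- move=> f mf f0; rewrite (ge0_integral_affine _ 0 _ a0 mf f0).
  by congr (_ * _)%E; apply: eq_integral => t _; rewrite /affine_map addr0 mulrC.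
- exact: measurable_funM.
- by move=> t; rewrite normrM invfM mulrC mulfVK ?normr_eq0.
Qed.

Lemma mul_haar_set1 : mul_haar [set 0] = 0%E.
Proof. by rewrite /Defs.mul_haar integral_set1. Qed.

Lemma measurable_aff_mul (g : R * R) :
  measurable_fun setT (aff_mul g : measurableTypeR R * measurableTypeR R ->
    measurableTypeR R * measurableTypeR R).
Proof.
apply/measurable_fun_pair => /=.
- by apply: measurable_funD => //; apply: measurable_funM => //.
- by apply: measurable_funM => //.
Qed.

(** Left translation by (b, a) acts on the variables separately, by x |-> ax + b
    and y |-> ay, so that Tonelli reduces it to two affine changes of variable,
    each of which contributes a factor |a|. *)
Lemma aff_haar_invariant (g : affG R)
    (A : set (measurableTypeR R * measurableTypeR R)) : measurable A ->
  aff_haar (aff_mul (\val g) @^-1` A) = aff_haar A.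
Proof.
case: g => -[b a] /= a0 mA.
apply: (density_measure_preserving _ _ (`|a| ^+ 2)) => //.
- move=> f mf f0.
  have mfg := measurableT_comp mf (measurable_aff_mul (b, a)).
  rewrite !fubini_tonelli2//=.
  have mG := @measurable_fun_fubini_tonelli_G _ _ _ _ _ leb f mf f0.
  rewrite (ge0_integral_affine _ 0 _ a0 mG); last first.
    by move=> y; apply: integral_ge0 => x _; exact: f0.
  rewrite expr2 EFinM -muleA; congr (_ * _)%E.
  have G0 : forall y, (0 <= fubini_G leb (f \o aff_mul (b, a)) y)%E.
    by move=> y; apply: integral_ge0 => x _; exact: f0.
  have mGg := @measurable_fun_fubini_tonelli_G _ _ _ _ _ leb _ mfg (fun=> f0 _).
  rewrite -ge0_integralZl//; last by move=> x _; exact: G0.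
  apply: eq_integral => y _; rewrite /fubini_G /affine_map addr0.
  rewrite (ge0_integral_affine _ b _ a0)//=.
  exact: measurable_fun_pair1.
- exact: measurable_aff_mul.
- rewrite (_ : (fun x => _) = (fun x : measurableTypeR R * measurableTypeR R =>
      (`|x.2|^-1) ^+ 2)).
    by apply: measurable_funX; exact: (measurableT_comp measurable_normV).
  by apply/funext => x; rewrite exprVn.
- by move=> x; rewrite /aff_mul/= normrM exprMn [in RHS]invfM mulVKf ?expf_neq0 ?normr_eq0.
Qed.

End haar_invariance.
(** * Composition with a measure-preserving map *)

Section measure_preserving.
Context {d} {T : measurableType d} {R : realType}.
Variable mu : {measure set T -> \bar R}.
Variable phi : T -> T.
Hypothesis mphi : measurable_fun setT phi.
Hypothesis phi_mu : forall A, measurable A -> mu (phi @^-1` A) = mu A.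

Lemma ae_comp_preserving (P : T -> Prop) :
  {ae mu, forall t, P t} -> {ae mu, forall t, P (phi t)}.
Proof.
move=> [N [mN N0 PN]]; exists (phi @^-1` N); split.
- by rewrite -[X in measurable X]setTI; exact: mphi.
- by rewrite -N0; exact: phi_mu.
- by move=> t /= /PN.
Qed.

Lemma ge0_integral_preserving (f : T -> \bar R) :
  measurable_fun setT f -> (forall t, (0 <= f t)%E) ->
  (\int[mu]_t f (phi t) = \int[mu]_t f t)%E.
Proof.
move=> mf f0.
rewrite -[LHS]/(\int[mu]_(t in phi @^-1` setT) (f \o phi) t)%E.
rewrite -(ge0_integral_pushforward mphi)//.
by apply: eq_measure_integral => A mA _; exact: phi_mu.
Qed.

End measure_preserving.

(** * Square-integrable complex functions *)

Section complex_modulus.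
Context {R : realType}.

Lemma normc_ge0 (z : R[i]) : 0 <= Normc.normc z.
Proof. by case: z => a b /=; rewrite sqrtr_ge0. Qed.

Lemma normc_conj (z : R[i]) : Normc.normc z^* = Normc.normc z.
Proof. by case: z => a b /=; rewrite sqrrN. Qed.

Lemma normr_Re_le (z : R[i]) : `|complex.Re z| <= Normc.normc z.
Proof.
by case: z => a b /=; rewrite -sqrtr_sqr ler_wsqrtr// lerDl sqr_ge0.
Qed.

Lemma normr_Im_le (z : R[i]) : `|complex.Im z| <= Normc.normc z.
Proof.
by case: z => a b /=; rewrite -sqrtr_sqr ler_wsqrtr// lerDr sqr_ge0.
Qed.

Lemma normc_le_ReIm (z : R[i]) :
  Normc.normc z <= `|complex.Re z| + `|complex.Im z|.
Proof.
case: z => a b /=; rewrite -[leRHS]ger0_norm ?addr_ge0// -sqrtr_sqr.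
rewrite ler_wsqrtr// sqrrD !real_normK ?num_real//.
by rewrite [leRHS]addrAC lerDl mulrn_wge0 ?mulr_ge0.
Qed.

End complex_modulus.

Section L2_theory.
Context {d} {T : measurableType d} {R : realType}.
Variable mu : {measure set T -> \bar R}.
Implicit Types (f g e : T -> R[i]^o) (x y : L2 mu).

Lemma cmeasurableM f g : cmeasurable f -> cmeasurable g ->
  cmeasurable (fun t => f t * g t : R[i]^o).
Proof.
move=> [f1 f2] [g1 g2]; split.
- rewrite (_ : (fun t => _) = (fun t => complex.Re (f t) * complex.Re (g t)) \-
    (fun t => complex.Im (f t) * complex.Im (g t))).
    by apply: measurable_funB; exact: measurable_funM.
  by apply/funext => t /=; case: (f t); case: (g t).
- rewrite (_ : (fun t => _) = (fun t => complex.Re (f t) * complex.Im (g t)) \+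
    (fun t => complex.Im (f t) * complex.Re (g t))).
    by apply: measurable_funD; exact: measurable_funM.
  by apply/funext => t /=; case: (f t); case: (g t).
Qed.

Lemma cmeasurable_conj f : cmeasurable f ->
  cmeasurable (fun t => (f t)^* : R[i]^o).
Proof.
move=> [f1 f2]; split.
- by rewrite (_ : (fun t => _) = (fun t => complex.Re (f t)))//;
    apply/funext => t; case: (f t).
- rewrite (_ : (fun t => _) = \- (fun t => complex.Im (f t))).
    exact: measurableT_comp.
  by apply/funext => t /=; case: (f t).
Qed.

Lemma cmeasurable_comp (phi : T -> T) f : measurable_fun setT phi ->
  cmeasurable f -> cmeasurable (f \o phi).
Proof.
move=> mphi [f1 f2]; split.
- exact: (measurableT_comp f1 mphi).
- exact: (measurableT_comp f2 mphi).
Qed.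

Lemma cmeasurable_indic (D : set T) : measurable D ->
  cmeasurable (fun t => (\1_D t)%:C : R[i]^o).
Proof.
by move=> mD; split; [exact: measurable_indic|exact: measurable_cst].
Qed.

Lemma sqint_L2_fun x : L2_fun x \in sqint mu.
Proof. exact: sqint_val. Qed.

Lemma cmeasurable_L2_fun x : cmeasurable (L2_fun x).
Proof. by have /sqintP[] := sqint_L2_fun x. Qed.

Lemma sqint_mull e f : cmeasurable e -> (forall t, Normc.normc (e t) <= 1) ->
  f \in sqint mu -> (fun t => e t * f t : R[i]^o) \in sqint mu.
Proof.
move=> me e1 /sqintP[mf nf]; have mef := cmeasurableM _ _ me mf.
apply/sqintP; split => //; apply: le_lt_trans nf.
apply: le_Lnorm2; [exact: normc_measurable|exact: normc_measurable|] => t.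
by rewrite normc_ge0 Normc.normcM ler_piMl ?normc_ge0.
Qed.

Lemma cLnorm2_comp (phi : T -> T) f : measurable_fun setT phi ->
  (forall A, measurable A -> mu (phi @^-1` A) = mu A) -> cmeasurable f ->
  cLnorm2 mu (f \o phi) = cLnorm2 mu f.
Proof.
move=> mphi phi_mu mf; rewrite /cLnorm2 unlock; congr (_ `^ _)%E.
apply: (@ge0_integral_preserving _ _ _ mu phi mphi phi_mu
  (fun t => `|(EFin \o (fun t => Normc.normc (f t))) t| `^ 2)%E).
- apply: (@measurableT_comp _ _ _ _ _ _ (@poweR R ^~ 2)) => //.
    exact: measurable_poweR.
  by apply: measurableT_comp => //; exact/measurable_EFinP/normc_measurable.
- by move=> t; rewrite poweR_ge0.
Qed.

Lemma sqint_comp (phi : T -> T) f : measurable_fun setT phi ->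
  (forall A, measurable A -> mu (phi @^-1` A) = mu A) ->
  f \in sqint mu -> f \o phi \in sqint mu.
Proof.
move=> mphi phi_mu /sqintP[mf nf]; apply/sqintP; split.
- exact: cmeasurable_comp.
- by rewrite cLnorm2_comp.
Qed.

Lemma Re_L2_norm x : complex.Re `|x| = fine (cLnorm2 mu (L2_fun x)).
Proof. by []. Qed.

(** The norm of a class is defined through a chosen representative; this computes
    it from the function at hand. *)
Lemma L2_norm_class f : f \in sqint mu ->
  complex.Re `|L2_class mu f| = fine (cLnorm2 mu f).
Proof.
move=> fP; rewrite Re_L2_norm; congr fine.
by apply: (ae_eq_cLnorm2 (f := repr _) (g := Sub f fP)); exact: L2_classE.
Qed.

Lemma L2_norm_ge0 x : 0 <= complex.Re `|x|.
Proof. by rewrite Re_L2_norm fine_ge0// cLnorm2_ge0. Qed.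

Let herm x y t : R[i] := L2_fun x t * (L2_fun y t)^*.

Let cmeasurable_herm x y : cmeasurable (herm x y).
Proof.
apply: cmeasurableM; first exact: cmeasurable_L2_fun.
exact/cmeasurable_conj/cmeasurable_L2_fun.
Qed.

(** Hoelder's inequality with p = q = 2 for the moduli. *)
Let integral_normc_herm x y :
  (\int[mu]_t (Normc.normc (herm x y t))%:E <=
   (complex.Re `|x| * complex.Re `|y|)%:E)%E.
Proof.
have fin (z : L2 mu) : cLnorm2 mu (L2_fun z) \is a fin_num.
  have /sqintP[_ ?] := sqint_L2_fun z.
  by rewrite ge0_fin_numE// cLnorm2_ge0.
have mx := normc_measurable (cmeasurable_L2_fun x).
have my := normc_measurable (cmeasurable_L2_fun y).
have := @hoelder _ _ _ mu _ _ 2 2 mx my (ltr0Sn _ 1) (ltr0Sn _ 1).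
rewrite -[X in (X + X)%R]div1r -splitr => /(_ erefl).
rewrite Lnorm1 !Re_L2_norm EFinM !fineK//.
under eq_integral do rewrite /= ger0_norm ?mulr_ge0 ?normc_ge0//.
under [in X in _ -> X]eq_integral do rewrite Normc.normcM normc_conj.
by [].
Qed.

Let integrable_normc_herm x y :
  mu.-integrable setT (EFin \o (fun t => Normc.normc (herm x y t))).
Proof.
apply/integrableP; split.
  exact/measurable_EFinP/normc_measurable/cmeasurable_herm.
under eq_integral do rewrite /comp gee0_abs ?lee_fin ?normc_ge0//.
by apply: le_lt_trans (integral_normc_herm x y) _; rewrite ltry.
Qed.

Lemma integrable_Re_herm x y : mu.-integrable setT
  (EFin \o (fun t => complex.Re (L2_fun x t * (L2_fun y t)^*))).
Proof.
apply: le_integrable (integrable_normc_herm x y) => //.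
- by apply/measurable_EFinP; have [] := cmeasurable_herm x y.
- by move=> t _; rewrite lee_fin [leRHS]ger0_norm ?normc_ge0// normr_Re_le.
Qed.

Lemma integrable_Im_herm x y : mu.-integrable setT
  (EFin \o (fun t => complex.Im (L2_fun x t * (L2_fun y t)^*))).
Proof.
apply: le_integrable (integrable_normc_herm x y) => //.
- by apply/measurable_EFinP; have [] := cmeasurable_herm x y.
- by move=> t _; rewrite lee_fin [leRHS]ger0_norm ?normc_ge0// normr_Im_le.
Qed.

(** Cauchy-Schwarz up to a constant: the real and the imaginary part are each
    bounded by the integral of the modulus. *)
Lemma normc_L2_inner_le x y :
  Normc.normc (L2_inner x y) <= 2 * (complex.Re `|x| * complex.Re `|y|).
Proof.
have I0 : \int[mu]_t Normc.normc (herm x y t) <= complex.Re `|x| * complex.Re `|y|.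
  rewrite -lee_fin fineK ?integral_normc_herm//.
  exact: (integrable_fin_num measurableT (integrable_normc_herm x y)).
apply: le_trans (normc_le_ReIm _) _; rewrite mulr2n mulrDl mul1r; apply: lerD.
- apply: le_trans (le_normr_Rintegral measurableT (integrable_Re_herm x y)) _.
  apply: le_trans I0; apply: le_Rintegral => //.
  + exact: integrable_abse (integrable_Re_herm x y).
  + by move=> t _; exact: normr_Re_le.
- apply: le_trans (le_normr_Rintegral measurableT (integrable_Im_herm x y)) _.
  apply: le_trans I0; apply: le_Rintegral => //.
  + exact: integrable_abse (integrable_Im_herm x y).
  + by move=> t _; exact: normr_Im_le.
Qed.

(** A sum of inner products is the integral of k as soon as the sum of the
    integrands agrees almost everywhere with k; the pairs of vectors may be
    unrelated, as are the contributions of the two half-lines. *)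
Lemma L2_inner_add x y x' y' (k : T -> R[i]^o) : cmeasurable k ->
  {ae mu, forall t, L2_fun x t * (L2_fun y t)^* +
    L2_fun x' t * (L2_fun y' t)^* = k t} ->
  L2_inner x y + L2_inner x' y' =
    (\int[mu]_t complex.Re (k t)) +i* (\int[mu]_t complex.Im (k t)).
Proof.
move=> [mk1 mk2] hk; rewrite /L2_inner.
have [r1 i1] := (integrable_Re_herm x y, integrable_Im_herm x y).
have [r2 i2] := (integrable_Re_herm x' y', integrable_Im_herm x' y').
rewrite -[LHS]/(_ +i* _) -!RintegralD//.
congr (_ +i* _); rewrite /Rintegral; congr fine; apply: ae_eq_integral => //.
- by apply/measurable_EFinP/measurable_funD;
    exact/measurable_EFinP/(measurable_int mu).
- exact/measurable_EFinP.
- by apply: filterS hk => t <- _; case: (L2_fun x t * _) => ? ?; case: (_ * _).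
- by apply/measurable_EFinP/measurable_funD;
    exact/measurable_EFinP/(measurable_int mu).
- exact/measurable_EFinP.
- by apply: filterS hk => t <- _; case: (L2_fun x t * _) => ? ?; case: (_ * _).
Qed.

Lemma ae_L2_fun0 : {ae mu, forall t, L2_fun (0 : L2 mu) t = 0}.
Proof.
have -> : (0 : L2 mu) = \pi_(L2 mu)%qT 0 by rewrite raddf0.
exact: (L2_pi_fun (0 : L2fun mu)).
Qed.

Lemma ae_L2_funB x y :
  {ae mu, forall t, L2_fun (x - y) t = L2_fun x t - L2_fun y t}.
Proof.
have -> : x - y = \pi_(L2 mu)%qT (repr x - repr y) by rewrite raddfB/= !reprK.
exact: (L2_pi_fun (repr x - repr y)).
Qed.

Lemma L2_inner_ae x y (k : T -> R[i]^o) : cmeasurable k ->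
  {ae mu, forall t, L2_fun x t * (L2_fun y t)^* = k t} ->
  L2_inner x y =
    (\int[mu]_t complex.Re (k t)) +i* (\int[mu]_t complex.Im (k t)).
Proof.
have /L2_inner_add I0 : {ae mu, forall t, L2_fun (0 : L2 mu) t *
    (L2_fun (0 : L2 mu) t)^* + L2_fun (0 : L2 mu) t *
    (L2_fun (0 : L2 mu) t)^* = (0 : R[i]^o)}.
  by apply: filterS ae_L2_fun0 => t ->; rewrite !mul0r addr0.
move=> mk xyk; rewrite -(@L2_inner_add x y 0 0 k mk); last first.
  by apply: filterS2 xyk ae_L2_fun0 => t <- ->; rewrite mul0r addr0.
have /eqP : L2_inner (0 : L2 mu) 0 + L2_inner (0 : L2 mu) 0 = 0.
  rewrite I0; last by split; exact: measurable_cst.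
  by rewrite !Rintegral_cst ?mul0r.
by rewrite -mulr2n mulrn_eq0 /= => /eqP ->; rewrite addr0.
Qed.

Lemma L2_inner_ae0 x y :
  {ae mu, forall t, L2_fun x t * (L2_fun y t)^* = 0} -> L2_inner x y = 0.
Proof.
move=> /(@L2_inner_ae x y (cst 0)) ->; first by rewrite /= !Rintegral_cst ?mul0r.
by split; exact: measurable_cst.
Qed.

(** The function 1_D x satisfies the conditions defining the projection of x, so
    the chosen vector p does too. Testing x - p against 1_D (x - p), which lies
    in S, gives a vanishing integral of 1_D |x - p|^2: p agrees with x on D, and
    it vanishes off D as a member of S. *)
Lemma orth_proj_indic (S : set (L2 mu)) (D : set T) x : measurable D ->
  (forall y, S y <-> {ae mu, forall t, ~ D t -> L2_fun y t = 0}) ->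
  {ae mu, forall t, L2_fun (orth_proj S x) t = (\1_D t)%:C * L2_fun x t}.
Proof.
move=> mD SE.
have cut (z : L2 mu) : {ae mu, forall t, L2_fun (L2_class mu
    (fun t => (\1_D t)%:C * L2_fun z t)) t = (\1_D t)%:C * L2_fun z t}.
  apply/L2_classE/(@sqint_mull (fun t => (\1_D t)%:C) (L2_fun z)) => //.
  - exact: cmeasurable_indic.
  - by move=> t; rewrite indicE; case: (_ \in _); rewrite ?Normc.normc1 ?Normc.normc0 ?ler01.
  - exact: sqint_L2_fun.
have cutS (z : L2 mu) : S (L2_class mu (fun t => (\1_D t)%:C * L2_fun z t)).
  apply/SE; apply: filterS (cut z) => t -> Dt.
  by rewrite indicE memNset// mul0r.
have [Sp xp] : S (orth_proj S x) /\
    forall z, S z -> L2_inner (x - orth_proj S x) z = 0.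
  apply: (@xgetPex _ 0 [set y | S y /\ forall z, S z -> L2_inner (x - y) z = 0]).
  exists (L2_class mu (fun t => (\1_D t)%:C * L2_fun x t)); split => // z /SE Sz.
  apply: L2_inner_ae0.
  near=> t; have -> : L2_fun (x - L2_class mu (fun t => (\1_D t)%:C * L2_fun x t)) t
    = L2_fun x t - (\1_D t)%:C * L2_fun x t.
    rewrite (near (ae_L2_funB _ _) t)//; congr (_ - _).
    by near: t; exact: cut.
  have [Dt|Dt] := pselect (D t).
    by rewrite indicE mem_set// mul1r subrr mul0r.
  have -> : L2_fun z t = 0 by move: Dt; near: t.
  by rewrite rmorph0 mulr0.
set p := orth_proj S x in Sp xp *.
have /xp := cutS (x - p).
rewrite (@L2_inner_ae _ _ (fun t => ((\1_D t) *
  Normc.normc (L2_fun (x - p) t) ^+ 2)%:C)); last 2 first.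
- split; last exact: measurable_cst.
  apply: measurable_funM; first exact: measurable_indic.
  exact/measurable_funX/normc_measurable/cmeasurable_L2_fun.
- apply: filterS (cut (x - p)) => t ->.
  rewrite rmorphM /= (conjc_real _ : Num.conj _ = _) mulrCA -normCK rmorphM rmorphXn /=.
  by congr (_ * _ ^+ 2); rewrite normc_def; case: (L2_fun _ _).
move=> /(congr1 (@complex.Re R)) /= I0.
set q := x - p in I0.
have iw : mu.-integrable setT
    (EFin \o (fun t => \1_D t * Normc.normc (L2_fun q t) ^+ 2)).
  apply: le_integrable (integrable_normc_herm q q) => //.
    apply/measurable_EFinP/measurable_funM; first exact: measurable_indic.
    exact/measurable_funX/normc_measurable/cmeasurable_L2_fun.
  move=> t _; rewrite lee_fin /herm Normc.normcM normc_conj -expr2 normrM.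
  rewrite [leRHS]ger0_norm ?exprn_ge0 ?normc_ge0//.
  rewrite [X in _ * X]ger0_norm ?exprn_ge0 ?normc_ge0//.
  rewrite ler_piMl ?exprn_ge0 ?normc_ge0// indicE.
  by case: (_ \in _); rewrite ?normr1 ?normr0.
have w0 : {ae mu, forall t, \1_D t * Normc.normc (L2_fun q t) ^+ 2 = 0}.
  have /ae_eq_integral_abs : measurable_fun setT
      (EFin \o (fun t => \1_D t * Normc.normc (L2_fun q t) ^+ 2)).
    exact: measurable_int iw.
  move=> /(_ mu measurableT)[+ _].
  under eq_integral do rewrite /comp gee0_abs ?lee_fin ?mulr_ge0 ?exprn_ge0 ?normc_ge0//.
  rewrite -[X in X = _ -> _]fineK; last exact: integrable_fin_num iw.
  by rewrite -/(Rintegral _ _ _) I0 => /(_ erefl); apply: filterS => t /(_ I)[].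
near=> t; have [Dt|Dt] := pselect (D t).
- have : \1_D t * Normc.normc (L2_fun q t) ^+ 2 = 0 by near: t.
  rewrite indicE mem_set// mul1r => /eqP; rewrite expf_eq0/= => /eqP/Normc.eq0_normc.
  rewrite (near (ae_L2_funB _ _) t)// => /subr0_eq <-.
  by rewrite mul1r.
- have -> : L2_fun p t = 0 by move: Dt; near: t; exact/SE.
  by rewrite indicE memNset// mul0r.
Unshelve. all: by end_near.
Qed.

End L2_theory.
(** * Evaluation is bounded for the coefficient norm *)

Section coefficient_bound.
Context {d} {T : measurableType d} {R : realType}.
Context {mu : {measure set T -> \bar R}} {G : Type}.
Variable rho : G -> L2 mu -> L2 mu.
Hypothesis rho_contr : forall g x, complex.Re `|rho g x| <= complex.Re `|x|.

(** Choose an expansion of f whose cost is close to r. Its partial sums at g are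
    bounded by twice that cost, since each term is controlled by Cauchy-Schwarz,
    and they converge to f g. *)
Lemma normc_le_coef_norm (f : G -> R[i]) (r : R) (g : G) :
  coef_norm rho f = r%:E -> Normc.normc (f g) <= 2 * r.
Proof.
move=> fr; apply/ler_addgt0Pr => e e0.
(* The bound 2 (r + e/4) on the partial sums leaves e/2 for the distance from a
   partial sum to the limit. *)
have e4 : 0 < e / 2 / 2 by rewrite !divr_gt0.
have : (coef_norm rho f < (r + e / 2 / 2)%:E)%E by rewrite fr lte_fin ltrDl.
move=> /ereal_inf_lt[s [xi [eta [fE ->]]] slt].
have /cvgrPdist_lt/(_ (e / 2)%:C) := fE g.
rewrite ltcR divr_gt0// => /(_ isT)[N _ /(_ N (leqnn N))] /=.
set S := series _ N => fS.
have SN : Normc.normc S <= 2 * (r + e / 2 / 2).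
  rewrite -ler_pdivrMl//.
  rewrite -lee_fin; apply: le_trans (ltW slt).
  apply: (@le_trans _ _ (\sum_(0 <= n < N)
    (complex.Re (`|xi n| * `|eta n|))%:E)%E); last first.
    apply: nneseries_lim_ge => n _ _; rewrite lee_fin.
    by rewrite /= mulr0 subr0 mulr_ge0 ?L2_norm_ge0.
  rewrite sumEFin lee_fin ler_pdivrMl// mulr_sumr /S /series/=.
  elim: N {fS} @S => [|N IH].
    by rewrite !big_geq// Normc.normc0.
  rewrite !big_nat_recr//=; apply: le_trans (le_normcD _ _) (lerD IH _).
  apply: le_trans (normc_L2_inner_le _ _ _) _; rewrite ler_pM2l//.
  by rewrite /= mulr0 subr0 ler_wpM2r ?L2_norm_ge0 ?rho_contr.
have fSe : Normc.normc (f g - S) < e / 2.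
  by rewrite -ltcR; move: fS; rewrite normc_def; case: (_ - _).
rewrite -[f g](subrK S); apply: le_trans (le_normcD _ _) _.
apply: le_trans (lerD (ltW fSe) SN) _.
rewrite mulrDr addrCA lerD2l [2 * _]mulrC divfK// -splitr//.
Qed.

End coefficient_bound.
(** * The two representations of the affine group *)

Section affine_representations.
Context {R : realType}.
Implicit Types (g : affG R) (xi eta : L2mul R).

(** Translation preserves the measure, hence the norm. *)
Lemma left_regular_norm g (xi : L2aff R) :
  complex.Re `|left_regular g xi| = complex.Re `|xi|.
Proof.
have mg := measurable_aff_mul (\val (g^-1)%g).
have ig := aff_haar_invariant (g^-1)%g.
rewrite L2_norm_class; last exact: (sqint_comp _ _ _ mg ig (sqint_L2_fun _ xi)).
by rewrite (cLnorm2_comp _ _ _ mg ig (cmeasurable_L2_fun _ xi)).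
Qed.

Lemma fourier_norm_eval (f : affG R -> R[i]) (r : R) g :
  fourier_norm f = r%:E -> Normc.normc (f g) <= 2 * r.
Proof.
apply: normc_le_coef_norm => h xi; by rewrite left_regular_norm.
Qed.

Let character (b t : R) : R[i] := cos (2 * pi * b * t) +i* sin (2 * pi * b * t).

(** The formula on the right is square-integrable, the character having modulus 1
    and the dilation preserving the measure; the class is thus never the default
    one. *)
Lemma aff_rep_ae g xi : {ae @mul_haar R, forall t : R,
  L2_fun (aff_rep g xi) t =
    character (\val g).1 t * L2_fun xi (t * (\val g).2)}.
Proof.
case: g => -[b a] /= a0; apply: L2_classE.
have mb : measurable_fun setT (fun t : R => 2 * pi * b * t).
  exact: measurable_funM.
apply: (@sqint_mull _ _ _ (@mul_haar R) (character b)
  (fun t : R => L2_fun xi (t * a))).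
- split; apply: (measurableT_comp _ mb); apply: continuous_measurable_fun.
  + exact: continuous_cos.
  + exact: continuous_sin.
- by move=> t; rewrite /= cos2Dsin2 sqrtr1.
- apply: (@sqint_comp _ _ _ _ (fun t : measurableTypeR R => t * a) (L2_fun xi)).
  + exact: measurable_funM.
  + by move=> A mA; exact: mul_haar_invariant.
  + exact: sqint_L2_fun.
Qed.

Lemma mul_haar_ae_neq0 : {ae @mul_haar R, forall t : R, t != 0}.
Proof.
exists [set 0]; split; [exact: measurable_set1|exact: mul_haar_set1|].
by move=> t /= /negP; rewrite negbK => /eqP.
Qed.

Let Dp : set (measurableTypeR R) := [set t : R | 0 <= t].
Let Dm : set (measurableTypeR R) := [set t : R | t <= 0].

Let indicDp (t : R) : (\1_Dp t : R) = (0 <= t)%R%:R.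
Proof. by rewrite indicE; congr (nat_of_bool _)%:R; apply/idP/idP; rewrite inE. Qed.

Let indicDm (t : R) : (\1_Dm t : R) = (t <= 0)%R%:R.
Proof. by rewrite indicE; congr (nat_of_bool _)%:R; apply/idP/idP; rewrite inE. Qed.

Lemma orth_proj_Hplus xi : {ae @mul_haar R, forall t : R,
  L2_fun (orth_proj (@Hplus R) xi) t = (0 <= t)%R%:R%:C * L2_fun xi t}.
Proof.
have mD : measurable Dp.
  rewrite (_ : Dp = `[0, +oo[%classic); first exact: measurable_itv.
  by apply/seteqP; split => t /=; rewrite in_itv/= andbT.
apply: filterS (@orth_proj_indic _ _ _ _ (@Hplus R) Dp xi mD _) => [t|y].
  by rewrite indicDp.
have FF := ae_filter_ringOfSetsType (@mul_haar R).
by split => y0; apply: filterS y0 => t yt; rewrite /Dp/= => t0; apply: yt;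
  [rewrite ltNge; exact/negP|apply/negP; rewrite -ltNge].
Qed.

Lemma orth_proj_Hminus xi : {ae @mul_haar R, forall t : R,
  L2_fun (orth_proj (@Hminus R) xi) t = (t <= 0)%R%:R%:C * L2_fun xi t}.
Proof.
have mD : measurable Dm.
  rewrite (_ : Dm = `]-oo, 0]%classic); first exact: measurable_itv.
  by apply/seteqP; split => t /=; rewrite in_itv/=.
apply: filterS (@orth_proj_indic _ _ _ _ (@Hminus R) Dm xi mD _) => [t|y].
  by rewrite indicDm.
have FF := ae_filter_ringOfSetsType (@mul_haar R).
by split => y0; apply: filterS y0 => t yt; rewrite /Dm/= => t0; apply: yt;
  [rewrite ltNge; exact/negP|apply/negP; rewrite -ltNge].
Qed.

(** The heart of the matter: away from t = 0, the numbers t and ta lie in the same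
    half-line if a > 0 and in opposite ones if a < 0. *)
Lemma aff_coef_diag g xi eta :
  L2_inner (aff_rep g (orth_proj (@Hplus R) xi)) (orth_proj (@Hplus R) eta) +
  L2_inner (aff_rep g (orth_proj (@Hminus R) xi)) (orth_proj (@Hminus R) eta) =
  if 0 < (\val g).2 then L2_inner (aff_rep g xi) eta else 0.
Proof.
have a0 : (\val g).2 != 0 := svalP g.
(* Null sets are stable under dilation, so that what holds for almost every t
   also holds at ta for almost every t. *)
have mul_ae (P : R -> Prop) : {ae @mul_haar R, forall t : R, P t} ->
    {ae @mul_haar R, forall t : R, P (t * (\val g).2)}.
  apply: (@ae_comp_preserving _ _ _ _ (fun t : measurableTypeR R => t * (\val g).2)).
    exact: measurable_funM.
  by move=> A mA; exact: mul_haar_invariant.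
pose k (t : R) : R[i]^o :=
  if 0 < (\val g).2 then L2_fun (aff_rep g xi) t * (L2_fun eta t)^* else 0.
rewrite (@L2_inner_add _ _ _ (@mul_haar R) _ _ _ _ k).
- rewrite /k; case: ifP => _ //.
  by rewrite /= !Rintegral_cst ?mul0r.
- rewrite /k; case: (0 < _); last by split; exact: measurable_cst.
  apply: cmeasurableM; first exact: cmeasurable_L2_fun.
  exact/cmeasurable_conj/cmeasurable_L2_fun.
near=> t.
rewrite /k (near (aff_rep_ae g (orth_proj (@Hplus R) xi)) t)//.
rewrite (near (aff_rep_ae g (orth_proj (@Hminus R) xi)) t)//.
rewrite (near (aff_rep_ae g xi) t)//.
rewrite (near (mul_ae _ (orth_proj_Hplus xi)) t)//.
rewrite (near (mul_ae _ (orth_proj_Hminus xi)) t)//.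
rewrite (near (orth_proj_Hplus eta) t)// (near (orth_proj_Hminus eta) t)//.
have t0 : t != 0 by near: t; exact: mul_haar_ae_neq0.
have [aP|aN|aE] := ltgtP 0 (\val g).2; last by rewrite -aE eqxx in a0.
- rewrite pmulr_lge0// pmulr_lle0//.
  have [tP|tN|tE] := ltgtP 0 t; last by rewrite -tE eqxx in t0.
  + by rewrite !mul0r mulr0 mul0r addr0 !mul1r.
  + by rewrite !mul0r mulr0 mul0r add0r !mul1r.
- rewrite nmulr_lge0// nmulr_lle0//.
  by have [tP|tN|tE] := ltgtP 0 t; [|  |by rewrite -tE eqxx in t0];
    rewrite !(mul0r, mulr0, rmorph0, addr0).
Unshelve. all: by end_near.
Qed.

End affine_representations.
(** * Extension from elementary tensors *)

(** Approximation of u for the graph norm of f, which is what controls an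
    expression in which both u and f u occur. *)
Lemma dense_approx2 {K : numFieldType} {X Y : normedModType K} (S : set X)
    (f : X -> Y) (u : X) (e : K) : dense S -> continuous f -> 0 < e ->
  exists v, [/\ S v, `|u - v| < e & `|f u - f v| < e].
Proof.
move=> dS cf e0.
have nu : nbhs u ([set v | `|u - v| < e] `&` [set v | `|f u - f v| < e]).
  apply: filterI; first by apply/nbhs_normP; exists e.
  by have /cvgrPdist_lt/(_ e e0) := cf u.
have [v [vI Sv]] := dS _ (ex_intro _ u nu) (@open_interior _ _).
by have [? ?] := interior_subset vI; exists v.
Qed.

Theorem proposition5p6 (R : realType)
    (X : completeNormedModType R[i])
    (tau : {bilinear L2mul R -> conj_space (L2mul R) -> X})
    (tauP : is_projective_tensor tau)
    (Psi : {linear X -> (affG R -> R[i])})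
    (Psi_isometric : forall u, fourier_norm (Psi u) = (complex.Re `|u|)%:E)
    (Psi_onto : range Psi = @fourier_algebra R)
    (Psi_tensor : forall (xi eta : L2mul R) (g : affG R),
      Psi (tau xi eta) g = L2_inner (aff_rep g xi) eta)
    (Pdiag : {linear X -> X})
    (Pdiag_continuous : continuous Pdiag)
    (Pdiag_tensor : forall xi eta : L2mul R,
      Pdiag (tau xi eta) =
        tau (orth_proj (@Hplus R) xi) (orth_proj (@Hplus R) eta) +
        tau (orth_proj (@Hminus R) xi) (orth_proj (@Hminus R) eta)) :
  Psi \o Pdiag = @Pe R \o Psi.
Proof.
(* Norms in X are complex numbers whose imaginary part is zero. *)
have Re_norm (w : X) : `|w| = (complex.Re `|w|)%:C.
  by have := normr_ge0 w; case: `|w| => a b; rewrite lecE /= => /andP[/eqP ->].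
have Psi_bound (w : X) g : Normc.normc (Psi w g) <= 2 * complex.Re `|w|.
  exact/fourier_norm_eval/Psi_isometric.
(* The difference F is linear in u, vanishes on the algebraic tensor product, and
   is bounded by the norms of u and Pdiag u. *)
pose F u g := Psi (Pdiag u) g - Pe (Psi u) g.
have Pe_sub (f h : affG R -> R[i]) g : Pe (f - h) g = Pe f g - Pe h g.
  by rewrite /Pe; case: ifP => _; rewrite ?subr0.
have F_sub u v g : F (u - v) g = F u g - F v g.
  rewrite /F !linearB Pe_sub.
  rewrite -[(Psi (Pdiag u) - _) g]/(Psi (Pdiag u) g - Psi (Pdiag v) g).
  by rewrite !opprD addrACA.
have F_tensor s g : F (tensor_sum tau s) g = 0.
  rewrite /F /tensor_sum; elim: s => [|[xi eta] s IH].
    by rewrite big_nil !linear0 /Pe; case: ifP; rewrite subr0.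
  rewrite big_cons; set w := \sum_(p <- s) _ in IH *.
  have -> : tau xi eta + w = tau xi eta - (- w) by rewrite opprK.
  have F0 : F 0 g = 0 by rewrite -(subrr w) F_sub subrr.
  rewrite -/(F _ _) F_sub -[- w]sub0r F_sub F0 sub0r opprK [F w g]IH addr0.
  rewrite /F Pdiag_tensor linearD /= /Pe !fctE !Psi_tensor aff_coef_diag.
  by rewrite subrr.
apply/funext => u; apply/funext => g /=; apply/subr0_eq; rewrite -/(F u g).
apply/Normc.eq0_normc/eqP; rewrite eq_le normc_ge0 andbT.
apply/ler_addgt0Pr => e e0; rewrite add0r.
(* Twice the norms of u - v and of its image add up to at most 2 (e/4 + e/4). *)
have e4 : 0 < (e / 2 / 2)%:C :> R[i] by rewrite ltcR !divr_gt0.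
have [v [[s _ sv] uv Puv]] :=
  dense_approx2 _ _ u _ (tensor_dense tauP) Pdiag_continuous e4.
have -> : F u g = F (u - v) g by rewrite F_sub -sv F_tensor subr0.
rewrite Re_norm ltcR in uv; rewrite Re_norm ltcR in Puv.
have PeB w : Normc.normc (Pe (Psi w) g) <= 2 * complex.Re `|w|.
  rewrite /Pe; case: ifP => _; first exact: Psi_bound.
  by rewrite Normc.normc0 (le_trans _ (Psi_bound w g))// normc_ge0.
apply: le_trans (le_normcD _ _) _; rewrite normcN.
apply: le_trans (lerD (Psi_bound _ g) (PeB _)) _; rewrite linearB.
rewrite -mulrDr -ler_pdivlMl// mulrC [leRHS]splitr.
exact: lerD (ltW Puv) (ltW uv).
Qed.
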